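(* Let $k\ge 1$ be an integer, and let $G=(V,E)$ be a graph with $\tilde{\rho}(G)<k$. Then \[ \mathrm{sa}(G)\le k+15\log k+65 . \]
   Context: Graphs are finite, simple and undirected, with non-empty vertex set. $\log$ denotes the natural logarithm. For a graph $H$, $E(H)$ is its edge set and $n'(H)$ is the number of vertices in the largest connected component of $H$. The partition density of $G$ is \[ \tilde{\rho}(G)=\max_{H\subset G}\frac{|E(H)|}{n'(H)}, \] the maximum being over all (not necessarily induced) subgraphs $H$ of $G$ with at least one vertex. A star forest is a graph whose connected components are all isomorphic to star graphs (a star graph on $n$ vertices has one vertex adjacent to all $n-1$ others, and no other edges; isolated vertices are allowed as components). The star arboricity $\mathrm{sa}(G)$ is the minimum $t$ such that $G$ can be decomposed into $t$ edge-disjoint star forests, i.e. $E$ can be partitioned into $t$ sets each of which is the edge set of a star forest. *)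

(* Defs.v *)
From HB Require Import structures.
From mathcomp Require Import all_boot all_order all_algebra.

Set Implicit Arguments.
Unset Strict Implicit.
Unset Printing Implicit Defensive.

Import Order.TTheory GRing.Theory Num.Theory.

(* A finite simple undirected graph whose vertices are drawn from an ambient
   finite type T (so that a graph and its subgraphs live in one type): a pair
   (V, E) with V non-empty and E a set of 2-element subsets of V. *)
Definition is_sgraph (T : finType) (p : {set T} * {set {set T}}) : bool :=
  (p.1 != set0) && [forall e in p.2, (#|e| == 2) && (e \subset p.1)].

Record sgraph (T : finType) :=
  SGraph { sgraph_val : {set T} * {set {set T}}; _ : is_sgraph sgraph_val }.

HB.instance Definition _ (T : finType) := [isSub for @sgraph_val T].
HB.instance Definition _ (T : finType) := [Finite of sgraph T by <:].

Section Graphs.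
Variable T : finType.
Implicit Types (G H S : sgraph T) (x y : T).

Definition vertices G : {set T} := (sgraph_val G).1.
Definition edges G : {set {set T}} := (sgraph_val G).2.

Definition adj G : rel T := [rel x y | [set x; y] \in edges G].

Definition subgraph H G : bool :=
  (vertices H \subset vertices G) && (edges H \subset edges G).

Definition component_set G x : {set T} := [set y | connect (adj G) x y].

Fact component_subproof G x :
  is_sgraph (component_set G x, [set e in edges G | e \subset component_set G x]).
Proof.
rewrite /is_sgraph /=; apply/andP; split.
  by apply/set0Pn; exists x; rewrite inE connect0.
apply/forall_inP => e; rewrite inE => /andP[eG ->].
by case/andP: (valP G) => _ /forall_inP/(_ e eG)/andP[->].
Qed.

(* The connected component of x in G, as a graph; meant for x in vertices G. *)
Definition component G x : sgraph T := SGraph (component_subproof G x).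

Definition largest_component_order G : nat :=
  \max_(x in vertices G) #|vertices (component G x)|.

(* The ratios are non-negative and H = G is a valid index, so the default
   value 0 of the iterated maximum never matters. *)
Definition partition_density G : rat :=
  (\big[Num.max/0]_(H : sgraph T | subgraph H G)
     (#|edges H|%:R / (largest_component_order H)%:R))%R.

Definition is_star S : bool :=
  [exists c in vertices S,
     edges S == [set [set c; x] | x in vertices S :\ c]].

Definition star_forest S : bool :=
  [forall x in vertices S, is_star (component S x)].

Definition star_decomposable G (t : nat) : bool :=
  [exists F : {ffun 'I_t -> sgraph T},
    [&& [forall i, subgraph (F i) G && star_forest (F i)],
        [forall i, forall j, (i != j) ==> [disjoint edges (F i) & edges (F j)]]
      & \bigcup_i edges (F i) == edges G]].

Fact single_edge_subproof G (e : {set T}) :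
  e \in edges G -> is_sgraph (e, [set e]).
Proof.
move=> eG; case/andP: (valP G) => _ /forall_inP/(_ e eG)/andP[e2 _].
rewrite /is_sgraph /= -card_gt0 (eqP e2) /=.
by apply/forall_inP => f; rewrite inE => /eqP->; rewrite e2 subxx.
Qed.

Lemma single_edge_star_forest (e : {set T}) (pe : is_sgraph (e, [set e])) :
  star_forest (SGraph pe).
Proof.
set S := SGraph pe.
have e2 : #|e| == 2.
  by case/andP: (pe) => _ /forall_inP/(_ e); rewrite /= inE eqxx => /(_ isT)/andP[].
apply/forall_inP => x; rewrite [vertices S]/vertices /=.
move=> xe; have [y [xy defe]] : exists y, x != y /\ e = [set x; y].
  case/cards2P: e2 xe => a [b [ab ->]]; rewrite !inE => /orP[]/eqP->.
    by exists b.
  by exists a; rewrite eq_sym setUC.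
have cE : component_set S x = e.
  apply/setP => z; rewrite inE; apply/idP/idP.
    have cl : closed (adj S) (mem e).
      move=> a b; rewrite /adj /= /edges /= inE => /eqP abe.
      by rewrite -abe !inE !eqxx orbT.
    by move=> /(closed_connect cl) <-.
  rewrite {1}defe !inE => /orP[]/eqP->; first exact: connect0.
  by apply: connect1; rewrite /adj /= /edges /= inE defe.
apply/exists_inP; exists x; first by rewrite /vertices /= cE.
apply/eqP/setP => f; rewrite /vertices /edges /= cE !inE.
have -> : e :\ x = [set y].
  by rewrite defe; apply/setP => z; rewrite !inE;
     case: (eqVneq z x) => //= ->; rewrite (negPf xy).
rewrite imset_set1 inE -defe.
by case: eqP => //= ->; rewrite subxx.
Qed.

Lemma star_decomposable_exists G : exists t, star_decomposable G t.
Proof.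
exists #|edges G|; apply/existsP.
exists [ffun i => SGraph (single_edge_subproof (enum_valP i))].
apply/and3P; split.
- apply/forallP => i; rewrite ffunE single_edge_star_forest andbT.
  rewrite /subgraph /vertices /edges /= sub1set (enum_valP i) andbT.
  by case/andP: (valP G) => _ /forall_inP/(_ _ (enum_valP i))/andP[].
- apply/forallP => i; apply/forallP => j; apply/implyP => ij.
  rewrite !ffunE /edges /= disjoints1 inE.
  by apply: contra ij => /eqP/enum_val_inj->.
- apply/eqP/setP => e; apply/bigcupP/idP => [[i _]|eG].
    by rewrite ffunE /edges /= inE => /eqP->; apply: enum_valP.
  exists (enum_rank_in eG e) => //.
  by rewrite ffunE /edges /= inE enum_rankK_in.
Qed.

Definition star_arboricity G : nat := ex_minn (star_decomposable_exists G).

End Graphs.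

(* Main.v *)
(* If the density is < k, then Hall's theorem orients G with all outdegrees <= k.
   A random set S(v) of O(log k) colours is attached to each vertex v, and an
   edge oriented u -> v receives a colour from S(v) \ S(u), distinct for the
   different edges leaving u; each colour class is then a star forest whose
   centres are the heads of its edges.  By Hall's theorem such a choice at u
   fails only if some j out-neighbours of u see fewer than j colours outside
   S(u), which with k + O(log k) colours has probability < 1 / (4 (k+1)^3).

   A union bound suffices because G is essentially of size poly(k): as the
   density counts all the edges but only the largest component, G has at most k
   vertices of degree >= (k+1)^2 (k+1 of them would carry k+1 disjoint stars
   with k leaves) and no matching with 2k edges.  So only O(k^3) vertices have
   small degree and a neighbour of small degree, which gives at most
   4 (k+1)^3 events.  All remaining vertices have
   only neighbours of large degree; they orient every edge away from themselves
   and take S(v) empty, and a single event controls all of them. *)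

Require Import Defs.
From mathcomp Require Import all_boot all_order all_algebra.
From mathcomp Require Import reals exp.
From mathcomp Require Import sequences zify lra.
Import Order.TTheory GRing.Theory Num.Theory.

Set Implicit Arguments.
Unset Strict Implicit.
Unset Printing Implicit Defensive.

(** * Hall's marriage theorem *)

(** Induction on the size of [D], with [x0] fixed. If some non-empty [J] avoiding [x0] is tight,
    match [J] inside its neighbourhood and the rest outside it; Hall's condition survives there
    because [J] is tight. Otherwise every such set has a surplus, and [x0] may take any neighbour.
    The point [y0] only supplies values outside [D]. *)
Lemma hall_marriage (X Y : finType) (y0 : Y) (N : X -> {set Y}) (D : {set X}) :
    (forall J : {set X}, J \subset D -> #|J| <= #|\bigcup_(x in J) N x|) ->
  exists f : X -> Y,
    {in D &, injective f} /\ (forall x, x \in D -> f x \in N x).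
Proof.
have [n] := ubnP #|D|; elim: n N D => // n IHn N D; rewrite ltnS => le_Dn hallN.
have [-> | [x0 x0D]] := set_0Vmem D.
  by exists (fun=> y0); split=> [x x'|x]; rewrite inE.
have [/exists_inP[J] | noncrit] := boolP [exists J : {set X} in powerset (D :\ x0),
    (J != set0) && (#|\bigcup_(x in J) N x| <= #|J|)].
  rewrite powersetE subsetD1 => /andP[sJD x0J] /andP[J_n0 critJ].
  set NJ := \bigcup_(x in J) N x in critJ.
  have ltJD : #|J| < #|D|.
    by apply: proper_card; rewrite properE sJD; apply/subsetPn; exists x0.
  have [|K sKJ|f [f_inj fN]] := IHn N J; first exact: leq_trans ltJD le_Dn.
    by apply: hallN; apply: subset_trans sJD.
  have [||g [g_inj gN]] := IHn (fun x => N x :\: NJ) (D :\: J).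
  - apply: leq_trans le_Dn; rewrite cardsD (setIidPr sJD) ltn_subrL.
    by rewrite card_gt0 J_n0 card_gt0; apply/set0Pn; exists x0.
  - move=> K; rewrite subsetD => /andP[sKD dKJ].
    have := hallN (J :|: K); rewrite subUset sJD sKD => /(_ isT).
    rewrite bigcup_setU -/NJ cardsU [J :&: K]setIC (disjoint_setI0 dKJ) cards0.
    rewrite subn0 => leU.
    have: NJ :|: \bigcup_(x in K) N x \subset NJ :|: \bigcup_(x in K) (N x :\: NJ).
      rewrite subUset subsetUl; apply/bigcupsP => x xK; apply/subsetP => y yN.
      rewrite in_setU; case: (boolP (y \in NJ)) => //= ynN.
      by apply/bigcupP; exists x; rewrite // in_setD ynN.
    move/subset_leq_card/(leq_trans leU).
    move/leq_trans/(_ (leq_card_setU _ _)).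
    by move: critJ; lia.
  exists (fun x => if x \in J then f x else g x); split=> [x x' xD x'D|x xD].
    have disj y y' : y \in J -> y' \in D -> y' \notin J -> f y <> g y'.
      move=> yJ y'D y'J fg; have /setDP[_ /negP[]] : g y' \in N y' :\: NJ.
        by apply: gN; rewrite inE y'J.
      by rewrite -fg; apply/bigcupP; exists y => //; apply: fN.
    case: ifPn => xJ; case: ifPn => x'J.
    + exact: f_inj.
    + by move/disj => /(_ xJ x'D x'J).
    + by move/esym/disj => /(_ x'J xD xJ).
    + by apply: g_inj; rewrite inE ?xJ ?x'J.
  case: ifPn => xJ; first exact: fN.
  by have /setDP[] : g x \in N x :\: NJ by apply: gN; rewrite inE xJ.
have [y1 y1N] : exists y, y \in N x0.
  have := hallN [set x0]; rewrite sub1set x0D cards1 big_set1 => /(_ isT).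
  by rewrite card_gt0 => /set0Pn.
have [||g [g_inj gN]] := IHn (fun x => N x :\ y1) (D :\ x0).
- by apply: leq_trans le_Dn; rewrite [X in _ < X](cardsD1 x0) x0D.
- move=> K sK; have [->|K_n0] := eqVneq K set0; first by rewrite cards0.
  have ltK : #|K| < #|\bigcup_(x in K) N x|.
    rewrite ltnNge; apply: contra noncrit => leK; apply/exists_inP.
    by exists K; rewrite ?powersetE // K_n0.
  have -> : \bigcup_(x in K) (N x :\ y1) = (\bigcup_(x in K) N x) :\ y1.
    apply/setP=> y; rewrite !inE; apply/bigcupP/andP.
      by case=> x xK /setD1P[yy yN]; split=> //; apply/bigcupP; exists x.
    by case=> yy /bigcupP[x xK yN]; exists x => //; rewrite !inE yy.
  by rewrite -ltnS (leq_trans ltK) // (cardsD1 y1); case: (_ \in _).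
exists (fun x => if x == x0 then y1 else g x); split=> [x x' xD x'D|x xD].
  have gn x1 : x1 \in D -> x1 != x0 -> g x1 <> y1.
    move=> x1D x1x0 gy; have: g x1 \in N x1 :\ y1 by apply: gN; rewrite !inE x1x0.
    by rewrite gy !inE eqxx.
  case: (eqVneq x x0) => [->|xx0]; case: (eqVneq x' x0) => [->|xx0'] //.
  - by move/esym/gn; move=> /(_ x'D xx0').
  - by move/gn; move=> /(_ xD xx0).
  - by apply: g_inj; rewrite !inE ?xx0 ?xx0'.
case: (eqVneq x x0) => [->//|xx0].
by have /setD1P[] : g x \in N x :\ y1 by apply: gN; rewrite !inE xx0.
Qed.

(** * Probability estimate *)

(** Bernoulli's inequality 1 + n/b <= (1 + 1/b)^n, cleared of denominators. *)
Lemma bernoulli_expn b n : b ^ n * (b + n) <= b.+1 ^ n * b.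
Proof.
elim: n => [|n IHn]; first by rewrite !expn0 addn0.
rewrite !expnS -[b.+1 * _ * b]mulnA.
apply: leq_trans (leq_mul (leqnn b.+1) IHn).
rewrite [b * _]mulnC mulnCA -mulnA leq_mul2l; apply/orP; right; nia.
Qed.

Lemma double_expn_pred b n : b < n -> 2 * b ^ n <= b.+1 ^ n.
Proof.
case: b => [|b] lt_bn; first by rewrite exp1n exp0n //; lia.
rewrite -(@leq_pmul2r b.+1) //; apply: leq_trans (bernoulli_expn _ _).
by rewrite mulnAC mulnC leq_mul2l; apply/orP; right; lia.
Qed.

(** This is (1 - x/t)^t <= 2^(-x): each lowering of the base by one, from at most t, at least halves
    its t-th power. *)
Lemma expn_subl_half t x : x <= t -> (t - x) ^ t * 2 ^ x <= t ^ t.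
Proof.
elim: x => [|x IHx] lt_xt; first by rewrite subn0 expn0 muln1.
apply: leq_trans (IHx (ltnW lt_xt)); rewrite expnS mulnA leq_mul2r.
apply/orP; right; rewrite mulnC.
have -> : t - x = (t - x.+1).+1 by lia.
by apply: double_expn_pred; lia.
Qed.

Lemma bin_leq_expn n m : 'C(n, m) <= n ^ m.
Proof.
rewrite -(@leq_pmul2r m`!) ?fact_gt0 // bin_ffact.
apply: (@leq_trans (n ^ m)); last by rewrite leq_pmulr ?fact_gt0.
by elim: m => // m IHm; rewrite ffactnSr expnSr leq_mul // leq_subr.
Qed.


(** Linear bounds, both sharp at n = 5, through which k >= 2^l enters linear arithmetic. *)
Lemma pow2_lower n : 4 < n -> 10 * n <= 2 ^ n + 18 /\ 8 * n <= 2 ^ n + 8.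
Proof.
elim: n => // n IHn; rewrite leq_eqVlt => /orP[/eqP[<-] //|lt4n].
by have [] := IHn lt4n; rewrite expnS; lia.
Qed.

(* The union bound term for j out-neighbours and a vertex u with |S(u)| = s: the
   choices of the j vertices and of the j - 1 colours outside S(u) that they
   see, times the probability that all their c j draws land in these
   b = s + j - 1 colours. *)
Lemma hall_failure_bound k l t c w j s :
    2 ^ l <= k < 2 ^ l.+1 -> t = k + 10 * l + 65 -> c = 6 * l + 14 ->
    0 < j <= w -> w <= k -> s <= c ->
  'C(w, j) * 'C(t - s, j.-1) * (s + j.-1) ^ (c * j) * 2 ^ (4 * l + 7)
    <= t ^ (c * j).
Proof.
move=> /andP[k_ge k_lt] tE cE /andP[j_gt0 le_jw] le_wk le_sc.
set b := s + j.-1.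
have le_jk : j <= k := leq_trans le_jw le_wk.
have t_gt0 : 0 < t by lia.
have Cw : 'C(w, j) <= 'C(k, j) by apply: leq_bin2l.
(* If 2 b <= t, each draw lands in the b colours with probability at most 1/2. Of the gain 2^(c j),
   one factor 2^c pays for k 2^(4 l + 7) and each of the other j - 1 for a factor k t. *)
have [le2b|lt2b] := leqP (2 * b) t.
  have leC : 'C(w, j) * 'C(t - s, j.-1) <= k ^ j * t ^ j.-1.
    apply: leq_mul; first exact: leq_trans Cw (bin_leq_expn _ _).
    apply: leq_trans (bin_leq_expn _ _) _.
    by case: (j.-1) => // i; rewrite leq_exp2r // leq_subr.
  rewrite mulnAC; apply: (@leq_trans (2 ^ (c * j) * b ^ (c * j))); last first.
    by rewrite -expnMn; case: (posnP (c * j)) => [->//|?]; rewrite leq_exp2r.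
  rewrite leq_mul2r; apply/orP; right.
  apply: leq_trans (leq_mul leC (leqnn _)) _.
  have k2 : k * 2 ^ (4 * l + 7) <= 2 ^ c.
    apply: (@leq_trans (2 ^ l.+1 * 2 ^ (4 * l + 7))).
      by rewrite leq_mul2r (ltnW k_lt) orbT.
    by rewrite -expnD leq_exp2l //; lia.
  have kt2 : k * t <= 2 ^ c.
    have t2 : t <= 2 ^ (l + 7).
      have : 10 * l <= 2 ^ l * 10 by rewrite mulnC leq_mul2r (ltnW (ltn_expl _ _)).
      have : 0 < 2 ^ l by rewrite expn_gt0.
      by move: k_lt; rewrite expnS expnD; lia.
    apply: (@leq_trans (2 ^ l.+1 * 2 ^ (l + 7))); first by rewrite leq_mul // ltnW.
    by rewrite -expnD leq_exp2l //; lia.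
  have -> : k ^ j * t ^ j.-1 * 2 ^ (4 * l + 7)
          = k * 2 ^ (4 * l + 7) * (k * t) ^ j.-1.
    by rewrite -{1}(prednK j_gt0) expnS expnMn; lia.
  have -> : c * j = c + c * j.-1 by rewrite -mulnS prednK.
  rewrite [2 ^ (c + _)]expnD [2 ^ (c * _)]expnM leq_mul //.
  by case: (j.-1) => // i; rewrite leq_exp2r.
(* With x = t - b, both binomials are at most the y-th power of their base for
   y = min(j, x), while (1 - x/t)^(c j) <= 2^(- c j x / t) and
   j x >= y (t - s) / 2. *)
have l_ge5 : 4 < l.
  rewrite ltnNge; apply/negP => le_l4.
  (* The constant 65 enters here: 2 b > t forces k + 2 l >= 40, whereas l <= 4 gives k <= 31. *)
  have : k + 2 * l <= 39.
    clear - le_l4 k_lt.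
    by move: l le_l4 k_lt => [|[|[|[|[|?]]]]] //= _; rewrite !expnS expn0; lia.
  by lia.
have [pow1 pow2] := pow2_lower l_ge5.
set x := t - b.
have bt : b <= t by lia.
set y := minn j x.
have le_py : 4 * l + 7 <= y by rewrite /y leq_min; apply/andP; split; lia.
(* For x < j the binomials are reflected, using k - j <= x here and (t - s) - (j - 1) = x for the
   next one. *)
have Cj : 'C(w, j) <= k ^ y.
  apply: leq_trans Cw _; rewrite /y; case: (leqP j x) => [_|_].
    exact: bin_leq_expn.
  rewrite -bin_sub //; apply: leq_trans (bin_leq_expn _ _) _.
  by rewrite leq_pexp2l //; lia.
have Ct : 'C(t - s, j.-1) <= t ^ y.
  have le_exp i : i <= y -> (t - s) ^ i <= t ^ y.
    move=> le_iy; apply: (@leq_trans (t ^ i)); last by rewrite leq_pexp2l.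
    by case: i le_iy => // i _; rewrite leq_exp2r // leq_subr.
  case: (leqP j x) => [le_jx|lt_xj].
    by apply: leq_trans (bin_leq_expn _ _) (le_exp _ _); lia.
  rewrite -bin_sub; last by lia.
  by apply: leq_trans (bin_leq_expn _ _) (le_exp _ _); lia.
have kt : k * t <= 2 ^ (2 * l + 4).
  have -> : 2 * l + 4 = l.+1 + (l + 3) by lia.
  rewrite expnD leq_mul // ?(ltnW k_lt) //.
  by move: k_lt; rewrite expnS expnD; lia.
(* Raised to the power t, this follows from b^t 2^x <= t^t and (2 l + 5) t <= c max(j, x). Since j +
   x >= t - c + 1, the latter reduces to (6 l + 14) (6 l + 13) <= (2 l + 4) t. *)
have main : b ^ (c * j) * 2 ^ (y * (2 * l + 5)) <= t ^ (c * j).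
  rewrite -(leq_exp2r _ _ t_gt0) expnMn -!expnM.
  apply: (@leq_trans (b ^ (c * j * t) * 2 ^ (x * (c * j)))).
    rewrite leq_mul2l leq_exp2l //; apply/orP; right.
    have -> : x * (c * j) = y * (c * maxn j x).
      by rewrite /y; case: (leqP j x) => _; lia.
    rewrite -mulnA leq_mul2l; apply/orP; right.
    rewrite -(leq_pmul2l (isT : 0 < 2)).
    apply: (@leq_trans (c * (t - c).+1)); last first.
      by rewrite mulnCA leq_mul2l; apply/orP; right; lia.
    have le_sq : (6 * l + 14) * (6 * l + 13) <= (2 * l + 4) * t.
      apply: (@leq_trans ((2 * l + 4) * (18 * l + 57))); first by nia.
      by rewrite leq_mul2l; apply/orP; right; lia.
    have -> : (t - c).+1 = t - (6 * l + 13) by lia.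
    by rewrite mulnBr cE; nia.
  have := expn_subl_half (leq_subr b t); rewrite -/x.
  have -> : t - x = b by lia.
  move=> le_half; rewrite [c * j * t]mulnC [t ^ (_ * _)]expnM.
  by rewrite expnM [2 ^ _]expnM -expnMn leq_exp2r //; lia.
apply: leq_trans main; rewrite mulnAC mulnC leq_mul2l; apply/orP; right.
have -> : y * (2 * l + 5) = (2 * l + 4) * y + y by lia.
rewrite [2 ^ (_ * y + y)]expnD leq_mul //; last by rewrite leq_exp2l.
apply: leq_trans (leq_mul Cj Ct) _; rewrite -expnMn expnM.
by rewrite leq_exp2r //; lia.
Qed.

(** * Random colour sets *)

Lemma leq_card_bigcup (I S : finType) (P : pred I) (F : I -> {set S}) :
  #|\bigcup_(i | P i) F i| <= \sum_(i | P i) #|F i|.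
Proof.
elim/big_rec2: _ => [|i m A _ leA]; first by rewrite cards0.
by apply: leq_trans (leq_card_setU _ _) _; rewrite leq_add2l.
Qed.

Lemma exists_set_between (S : finType) (U X : {set S}) (m : nat) :
  U \subset X -> #|U| <= m <= #|X| ->
  exists Q : {set S}, [/\ U \subset Q, Q \subset X & #|Q| = m].
Proof.
move=> sUX /andP[leUm lemX].
have : [set Q : {set S} | Q \subset X :\: U & #|Q| == m - #|U|] != set0.
  by rewrite -card_gt0 cards_draws bin_gt0 cardsD (setIidPr sUX) leq_sub2r.
case/set0Pn=> Q; rewrite inE subsetD => /andP[/andP[sQX dQU] /eqP cQ].
exists (U :|: Q); split; rewrite ?subsetUl ?subUset ?sUX //.
by rewrite cardsU setIC (disjoint_setI0 dQU) cards0 cQ; lia.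
Qed.

Section Random.
Variables (T : finType) (t c : nat).

Notation draw := {ffun 'I_c -> 'I_t}.

(** The c draws may repeat, so the set can be smaller than c; in return all draws are
    independent. *)
Definition colors_at (f : {ffun T -> draw}) (v : T) : {set 'I_t} :=
  [set f v i | i : 'I_c].

Lemma card_colors_at f v : #|colors_at f v| <= c.
Proof. by apply: leq_trans (leq_imset_card _ _) _; rewrite card_ord. Qed.

Definition bad_draws (u : T) (W : {set T}) : {set {ffun T -> draw}} :=
  [set f | [exists J : {set T}, (J \subset W) &&
     (#|\bigcup_(v in J) (colors_at f v :\: colors_at f u)| < #|J|)]].

(** Independence of the values of a uniform [f], with probabilities written as cardinalities and
    denominators cleared. *)
Lemma card_ffun_constrained (D : finType) (u : T) (J : {set T}) (g : D)
    (B : {set D}) : u \notin J ->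
  #|[set f : {ffun T -> D} | (f u == g) && [forall v in J, f v \in B]]|
     * #|D| ^ (#|J|).+1 = #|{ffun T -> D}| * #|B| ^ #|J|.
Proof.
move=> uJ; set P := [set f | _].
pose F v : {set D} := if v == u then [set g] else if v \in J then B else setT.
have -> : #|P| = #|(family (fun v => mem (F v)) : simpl_pred {ffun T -> D})|.
  apply: eq_card => f; rewrite inE; apply/andP/familyP.
    move=> [/eqP fu /forall_inP fJ] v; rewrite /F.
    case: (eqVneq v u) => [->|_]; first by rewrite inE fu.
    by case: ifP => [/fJ|_] //; rewrite inE.
  move=> fF; split; first by have := fF u; rewrite /F eqxx inE.
  apply/forall_inP => v vJ; have := fF v; rewrite /F vJ.
  by case: eqP vJ uJ => // -> ->.
rewrite card_family foldrE big_map big_enum card_ffun /=.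
rewrite (bigD1 u) //= {1}/F eqxx cards1 mul1n.
rewrite (bigID (mem J)) /=.
have -> : \prod_(i | (i != u) && (i \in J)) #|F i| = #|B| ^ #|J|.
  rewrite -prod_nat_const; apply: eq_big => [v|v /andP[vu vJ]].
    by case: eqP uJ => [->|//] /negPf->.
  by rewrite /F (negPf vu) vJ.
have -> : \prod_(i | (i != u) && (i \notin J)) #|F i| = #|D| ^ #|~: (u |: J)|.
  rewrite -prod_nat_const; apply: eq_big => [v|v /andP[vu vJ]].
    by rewrite !inE negb_or.
  by rewrite /F (negPf vu) (negPf vJ) cardsT.
rewrite -mulnA -expnD mulnC; congr (_ ^ _ * _).
by rewrite -(cardsC (u |: J)) cardsU1 uJ addnC.
Qed.

(** Condition on the draw [g] at [u]. A failure yields [J] of size j + 1 and a set [Q] of j colours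
    outside S(u) such that all draws on [J] land in S(u) or [Q]. For fixed [g] and j, the sum over
    [J] and [Q] is handled by [hall_failure_bound]; the k values of j give the factor k. *)
Lemma card_bad_draws (k l : nat) (u : T) (W : {set T}) :
    2 ^ l <= k < 2 ^ l.+1 -> t = k + 10 * l + 65 -> c = 6 * l + 14 ->
    u \notin W -> #|W| <= k ->
  #|bad_draws u W| * 2 ^ (4 * l + 7) <= k * #|{ffun T -> draw}|.
Proof.
move=> hk tE cE uW leW.
pose im (g : draw) : {set 'I_t} := [set g i | i : 'I_c].
have le_im g : #|im g| <= c.
  by apply: leq_trans (leq_imset_card _ _) _; rewrite card_ord.
pose E (g : draw) (J : {set T}) (Q : {set 'I_t}) :=
  [set f : {ffun T -> draw} | (f u == g) &&
    [forall v in J, f v \in [set h | im h \subset im g :|: Q]]].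
pose JJ (j : 'I_k) := [set J : {set T} | J \subset W & #|J| == j.+1].
pose QQ g (j : 'I_k) := [set Q : {set 'I_t} | Q \subset ~: im g & #|Q| == j].
have cover_bad : bad_draws u W \subset
    \bigcup_g \bigcup_(j < k) \bigcup_(J in JJ j) \bigcup_(Q in QQ g j) E g J Q.
  apply/subsetP => f; rewrite inE => /exists_inP[J sJW].
  set U := \bigcup_(v in J) _ => ltUJ.
  have ltJk : #|J|.-1 < k by have := subset_leq_card sJW; lia.
  have sU : U \subset ~: colors_at f u.
    by apply/bigcupsP => v _; rewrite setDE subsetIr.
  (* The colours seen are padded to exactly |J| - 1, so that the sets [Q] are counted by a single
     binomial. *)
  have [|Q [sUQ sQ cQ]] := exists_set_between (m := #|J|.-1) sU.
    have := card_colors_at f u; have := cardsC (colors_at f u).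
    by rewrite card_ord; lia.
  apply/bigcupP; exists (f u) => //; apply/bigcupP; exists (Ordinal ltJk) => //.
  apply/bigcupP; exists J.
    by rewrite inE sJW /= prednK //; apply: leq_ltn_trans ltUJ.
  apply/bigcupP; exists Q; first by rewrite inE sQ /= cQ.
  rewrite inE eqxx /=; apply/forall_inP => v vJ; rewrite inE.
  apply/subsetP => i iv; rewrite inE; case: (boolP (i \in im (f u))) => //= iu.
  by apply: (subsetP sUQ); apply/bigcupP; exists v; rewrite // inE iu.
pose O := #|{ffun T -> draw}|; pose D := t ^ c.
have D_gt0 : 0 < D by rewrite expn_gt0; lia.
have cardD : #|{: draw}| = D by rewrite card_ffun !card_ord.
have leE g (j : 'I_k) J Q : J \in JJ j -> Q \in QQ g j ->
    #|E g J Q| * (D * t ^ (c * j.+1)) <= O * (#|im g| + j) ^ (c * j.+1).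
  rewrite !inE => /andP[sJW /eqP cJ] /andP[sQ /eqP cQ].
  have uJ : u \notin J by apply: contra uW; apply: (subsetP sJW).
  have := card_ffun_constrained g [set h | im h \subset im g :|: Q] uJ.
  rewrite cardD cJ expnS -/(E g J Q).
  have -> : D ^ j.+1 = t ^ (c * j.+1) by rewrite expnM.
  move=> ->.
  rewrite leq_mul2l expnM leq_exp2r //; apply/orP; right.
  have -> : #|[set h : draw | im h \subset im g :|: Q]|
     = #|(ffun_on (mem (im g :|: Q)) : simpl_pred draw)|.
    apply: eq_card => h; rewrite inE; apply/subsetP/ffun_onP => [sh i|sh i].
      by apply: sh; apply: imset_f.
    by case/imsetP=> i' _ ->; apply: sh.
  rewrite card_ffun_on card_ord leq_exp2r; last by lia.
  by apply: leq_trans (leq_card_setU _ _) _; rewrite cQ.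
have leS g (j : 'I_k) :
    #|\bigcup_(J in JJ j) \bigcup_(Q in QQ g j) E g J Q| * D * 2 ^ (4 * l + 7) <= O.
  have [ltWj|leWj] := ltnP #|W| j.+1.
    rewrite big1 ?cards0 // => J; rewrite inE => /andP[/subset_leq_card].
    by move=> leJ /eqP cJ; lia.
  have t_gt0 : 0 < t ^ (c * j.+1) by rewrite expn_gt0; lia.
  rewrite -(leq_pmul2r t_gt0).
  have h := @hall_failure_bound k l t c #|W| j.+1 #|im g| hk tE cE leWj leW (le_im g).
  apply: leq_trans (leq_mul (leqnn O) h).
  have cJJ : #|JJ j| = 'C(#|W|, j.+1) by rewrite cards_draws.
  have cQQ : #|QQ g j| = 'C(t - #|im g|, j).
    by rewrite cards_draws cardsCs setCK card_ord.
  set Y := \bigcup_(J in JJ j) _.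
  have leY : #|Y| * (D * t ^ (c * j.+1))
      <= 'C(#|W|, j.+1) * ('C(t - #|im g|, j) * (O * (#|im g| + j) ^ (c * j.+1))).
    apply: leq_trans (leq_mul (leq_card_bigcup _ _) (leqnn _)) _.
    rewrite big_distrl /= -cJJ -sum_nat_const; apply: leq_sum => J hJ.
    apply: leq_trans (leq_mul (leq_card_bigcup _ _) (leqnn _)) _.
    rewrite big_distrl /= -cQQ -sum_nat_const; apply: leq_sum => Q hQ.
    exact: leE.
  move: leY; set p := 2 ^ _; set q := t ^ _; set r := (_ + _) ^ _ => leY.
  have := leq_mul leY (leqnn p); congr (_ <= _); last by rewrite /=; lia.
  by lia.
rewrite -(leq_pmul2r D_gt0) mulnAC.
apply: leq_trans (leq_mul (leq_mul (subset_leq_card cover_bad) (leqnn D)) (leqnn _)) _.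
rewrite -mulnA; apply: leq_trans (leq_mul (leq_card_bigcup _ _) (leqnn _)) _.
rewrite big_distrl /= -/O.
apply: (@leq_trans (\sum_(g : draw) k * O)); last first.
  by rewrite sum_nat_const cardD mulnC.
apply: leq_sum => g _.
apply: leq_trans (leq_mul (leq_card_bigcup _ _) (leqnn _)) _.
rewrite big_distrl /=; apply: (@leq_trans (\sum_(j < k) O)); last first.
  by rewrite sum_nat_const card_ord.
by apply: leq_sum => j _; rewrite mulnA; apply: leS.
Qed.

(** Union bound: |K| k <= 4 (2^(l+1))^3 k < 2^(4 l + 6), which is below the 2^(4 l + 7) of
    [card_bad_draws]. *)
Lemma exists_good_draw (k l : nat) (K : {set T}) (W : T -> {set T}) :
    2 ^ l <= k < 2 ^ l.+1 -> t = k + 10 * l + 65 -> c = 6 * l + 14 ->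
    #|K| <= 4 * k.+1 ^ 3 ->
    (forall u, u \in K -> u \notin W u) ->
    (forall u, u \in K -> #|W u| <= k) ->
  exists f : {ffun T -> draw}, forall u, u \in K ->
    forall J : {set T}, J \subset W u ->
      #|J| <= #|\bigcup_(v in J) (colors_at f v :\: colors_at f u)|.
Proof.
move=> hk tE cE leK uW leW; have [k_ge k_lt] := andP hk.
pose Bad := \bigcup_(u in K) bad_draws u (W u).
have t_gt0 : 0 < t by lia.
have O_gt0 : 0 < #|{ffun T -> draw}|.
  by rewrite !card_ffun !card_ord !expn_gt0 t_gt0.
have ltBad : #|Bad| < #|{ffun T -> draw}|.
  rewrite -(ltn_pmul2r (expn_gt0 2 (4 * l + 7))).
  apply: (@leq_ltn_trans (#|K| * (k * #|{ffun T -> draw}|))).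
    apply: leq_trans (leq_mul (leq_card_bigcup _ _) (leqnn _)) _.
    rewrite big_distrl /= -sum_nat_const; apply: leq_sum => u uK.
    exact: card_bad_draws hk tE cE (uW u uK) (leW u uK).
  rewrite mulnA mulnC ltn_pmul2l //.
  apply: (@leq_ltn_trans (4 * (2 ^ l.+1) ^ 3 * k)).
    by rewrite leq_mul // (leq_trans leK) // leq_mul2l leq_exp2r.
  have -> : 4 * l + 7 = 2 + l.+1 * 3 + l.+1 + 1 by lia.
  rewrite !expnD -expnM; set q := 2 ^ _; have := expn_gt0 2 (l.+1 * 3).
  by rewrite -/q; nia.
have [f fBad] : exists f, f \notin Bad.
  apply/existsP; rewrite -negb_forall; apply: contraL ltBad => /forallP allBad.
  by rewrite -leqNgt; apply: subset_leq_card; apply/subsetP.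
exists f => u uK J sJW; rewrite leqNgt; apply: contra fBad => ltJ.
apply/bigcupP; exists u => //; rewrite inE; apply/exists_inP.
by exists J.
Qed.
End Random.

(** * Star forests from an orientation *)

Section Assembly.
Variables (T : finType) (G : sgraph T).
Implicit Types (x y z : T) (e : {set T}).

Lemma edge_spec e : e \in edges G -> #|e| = 2 /\ e \subset vertices G.
Proof. by case/andP: (valP G) => _ /forall_inP/(_ e)H /H/andP[/eqP]. Qed.

Lemma adjC x y : adj G x y = adj G y x.
Proof. by rewrite /adj /= setUC. Qed.

Lemma adj_neq x y : adj G x y -> x != y.
Proof. by move=> /edge_spec[]; rewrite cards2; case: eqP. Qed.

Lemma adj_vertex x y : adj G x y -> x \in vertices G.
Proof. by move=> /edge_spec[_ /subsetP]; apply; rewrite set21. Qed.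

Lemma edge_adj e : e \in edges G -> exists x y, e = [set x; y] /\ adj G x y.
Proof.
move=> eG; have [/eqP/cards2P[x [y [_ exy]]] _] := edge_spec eG.
by exists x, y; split=> //; rewrite /adj /= -exy.
Qed.

Lemma vertices_neq0 : vertices G != set0.
Proof. by case/andP: (valP G). Qed.

Fact spanning_subproof (F : {set {set T}}) :
  F \subset edges G -> is_sgraph (vertices G, F).
Proof.
move=> /subsetP sF; rewrite /is_sgraph /= vertices_neq0 /=.
by apply/forall_inP => e /sF/edge_spec[-> ->].
Qed.

Lemma set2_eq x y z w :
  [set x; y] = [set z; w] -> (x = z /\ y = w) \/ (x = w /\ y = z).
Proof.
move=> eq_e; have := set21 x y; rewrite eq_e => xin.
have := set22 x y; rewrite eq_e => yin.
have := set21 z w; rewrite -eq_e => zin; have := set22 z w; rewrite -eq_e => win.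
move: xin yin zin win; rewrite !inE.
by do 4!case/pred2P=> ?; subst; tauto.
Qed.

(* [d x y] orients the edge [xy] from [x] to [y]; in its colour class, the star
   containing this edge is centred at [y]. *)
Lemma star_decomposable_of_orientation (t : nat) (d : rel T)
    (col : T -> T -> 'I_t) :
    (forall x y, d x y -> adj G x y) ->
    (forall x y, adj G x y -> d x y || d y x) ->
    (forall x y, d x y -> ~~ d y x) ->
    (forall x y z, d x y -> d y z -> col x y != col y z) ->
    (forall x y z, d x y -> d x z -> col x y = col x z -> y = z) ->
  star_decomposable G t.
Proof.
move=> d_adj adj_d d_asym col_path col_inj.
have d_set2 x y x' y' : d x y -> d x' y' -> [set x; y] = [set x'; y'] ->
    x = x' /\ y = y'.
  by move=> dxy dxy' /set2_eq[//|[? ?]]; subst; have := d_asym _ _ dxy; rewrite dxy'.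
pose F i := [set [set p.1; p.2] | p : T * T & d p.1 p.2 && (col p.1 p.2 == i)].
have memF i x y : d x y -> ([set x; y] \in F i) = (col x y == i).
  move=> dxy; apply/imsetP/eqP => [[[x' y']]|coli].
    by rewrite inE /= => /andP[dxy' /eqP<-] /(d_set2 _ _ _ _ dxy dxy')[-> ->].
  by exists (x, y); rewrite // inE /= dxy coli eqxx.
have FP i e : e \in F i -> exists x y, [/\ e = [set x; y], d x y & col x y = i].
  by case/imsetP=> [[x y]]; rewrite inE /= => /andP[dxy /eqP<- ->]; exists x, y.
have sFG i : F i \subset edges G.
  by apply/subsetP => e /FP[x [y [-> dxy _]]]; apply: d_adj.
apply/existsP; exists [ffun i => SGraph (spanning_subproof (sFG i))].
apply/and3P; split; last first.
- apply/eqP/setP => e; apply/bigcupP/idP => [[i _]|].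
    by rewrite ffunE => /(subsetP (sFG i)).
  case/edge_adj=> x [y [-> /adj_d/orP[dxy|dyx]]].
    by exists (col x y); rewrite // ffunE /edges /= memF.
  by exists (col y x); rewrite // ffunE /edges /= setUC memF.
- apply/forallP => i; apply/forallP => j; apply/implyP => ij.
  rewrite !ffunE /edges /=; apply/pred0P => e /=; apply: contraNF ij.
  by case/andP=> /FP[x [y [-> dxy <-]]]; rewrite memF.
apply/forallP => i; rewrite ffunE; set S := SGraph _.
rewrite [subgraph _ _]/subgraph subxx [edges S]/edges /= sFG /=.
(* The head of the edge of colour [i] leaving [x], unique by [col_inj]; the default [x] covers
   centres and isolated vertices. *)
pose centre x := odflt x [pick y | d x y && (col x y == i)].
have centreE x y : d x y -> col x y = i -> centre x = y.
  move=> dxy coli; rewrite /centre; case: pickP => [z /andP[dxz /eqP colz]|].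
    by apply: (col_inj x) => //; rewrite coli.
  by move/(_ y); rewrite dxy coli eqxx.
have centre_head x y : d x y -> col x y = i -> centre y = y.
  move=> dxy coli; rewrite /centre; case: pickP => // z /andP[dyz /eqP colz].
  by have := col_path _ _ _ dxy dyz; rewrite coli colz eqxx.
have centreP x : centre x = x \/ (d x (centre x) /\ col x (centre x) = i).
  by rewrite /centre; case: pickP => [z /andP[dxz /eqP colz]|_]; [right|left].
have adj_centre x y : adj S x y -> centre x = centre y.
  move=> /FP[z [w [/set2_eq[[-> ->]|[-> ->]] dzw coli]]].
    by rewrite (centreE _ _ dzw coli) (centre_head _ _ dzw coli).
  by rewrite (centreE _ _ dzw coli) (centre_head _ _ dzw coli).
have conn_centre x : connect (adj S) x (centre x).
  case: (centreP x) => [->|[dx coli]]; first exact: connect0.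
  by apply: connect1; rewrite /adj /= /edges /= memF // coli.
have adjSC : connect_sym (adj S).
  by apply: sym_connect_sym => x y; rewrite /adj /= setUC.
(* The components are the fibres of [centre], which is constant along edges, while each vertex is
   joined to its centre. *)
have compE x : component_set S x = [set y | centre y == centre x].
  apply/setP => y; rewrite !inE; apply/idP/eqP => [cxy|cyx].
    have cl : closed (adj S) [pred z | centre z == centre x].
      by move=> z w /adj_centre; rewrite !inE => ->.
    by have := closed_connect cl cxy; rewrite !inE eqxx => /esym/eqP.
  by apply: connect_trans (conn_centre x) _; rewrite -cyx adjSC conn_centre.
have centreK x : centre (centre x) = centre x.
  by case: (centreP x) => [cx|[dx coli]]; [rewrite !cx|apply: centre_head dx coli].
apply/forall_inP => x xS; apply/exists_inP; exists (centre x).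
  by rewrite /vertices /= compE inE centreK.
apply/eqP/setP => e; rewrite /edges /vertices /= compE.
apply/idP/imsetP => [|[y]].
  rewrite inE => /andP[/FP[y [z [-> dyz coli]]] /subsetP sub].
  have := sub y; rewrite set21 inE (centreE _ _ dyz coli) => /(_ isT)/eqP zx.
  exists y; last by rewrite -zx setUC.
  by rewrite !inE -zx (centreE _ _ dyz coli) eqxx andbT adj_neq // d_adj.
rewrite !inE => /andP[yx /eqP cy] ->; case: (centreP y).
  by move=> cyy; rewrite -cy cyy eqxx in yx.
rewrite cy => -[dy coli]; rewrite setUC memF // coli eqxx /=.
by apply/subsetP => z; rewrite !inE => /pred2P[]->; rewrite ?centreK ?cy.
Qed.
End Assembly.

(** * Consequences of small partition density *)

Section Density.
Variables (T : finType) (G : sgraph T) (k : nat).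
Hypothesis density_lt : (partition_density G < k%:R)%R.
Implicit Types (H : sgraph T) (x y z : T) (e : {set T}).

Lemma largest_component_leq H s :
    (forall x, x \in vertices H ->
       exists C : {set T}, [/\ x \in C, closed (adj H) C & #|C| <= s]) ->
  largest_component_order H <= s.
Proof.
move=> hC; apply/bigmax_leqP => x /hC[C [xC cl leC]].
apply: leq_trans leC; apply: subset_leq_card; apply/subsetP => y.
by rewrite /vertices /= inE => /(closed_connect cl) <-.
Qed.

Lemma largest_component_gt0 H : 0 < largest_component_order H.
Proof.
have /set0Pn[x xH] := vertices_neq0 H.
apply: (@leq_trans #|vertices (component H x)|).
  by rewrite card_gt0; apply: vertices_neq0.
exact: (@leq_bigmax_cond _ _ (fun x => #|vertices (component H x)|)).
Qed.

Lemma card_edges_lt H : subgraph H G ->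
  #|edges H| < k * largest_component_order H.
Proof.
move=> sHG; rewrite -(ltr_nat rat) natrM -ltr_pdivrMr; last first.
  by rewrite ltr0n largest_component_gt0.
apply: le_lt_trans density_lt.
by apply: (le_bigmax_cond _ (fun H => (#|edges H|%:R / (largest_component_order H)%:R)%R)).
Qed.

Lemma spanning_subgraph (F : {set {set T}}) (sF : F \subset edges G) :
  subgraph (SGraph (spanning_subproof sF)) G.
Proof. by rewrite /subgraph subxx. Qed.

Definition neighbours x := [set y | adj G x y].

(** With k + 1 such vertices as hubs, each keeps at least (k+1)^2 - (k+1) = k (k+1) neighbours that
    are not hubs, enough to reserve k private leaves for every hub. *)
Definition high_degree := [set x | k.+1 ^ 2 <= #|neighbours x|].

Hypothesis k_gt0 : 0 < k.

(** A set of edges covering [V] has no component larger than [V], so it has fewer than k |V| edges;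
    this is Hall's condition. *)
Lemma exists_orientation : exists d : rel T,
  [/\ forall x y, d x y -> adj G x y,
      forall x y, adj G x y -> d x y || d y x,
      forall x y, d x y -> ~~ d y x
    & forall x, #|[set y | d x y]| <= k].
Proof.
have /set0Pn[x0 _] := vertices_neq0 G.
pose i0 : 'I_k := Ordinal k_gt0.
(* Every edge chooses its tail together with one of k slots at that tail. *)
have [J sJ|h [h_inj hN]] := hall_marriage (x0, i0)
    (N := fun e => setX e [set: 'I_k]) (D := edges G).
  have [->|J_n0] := eqVneq J set0; first by rewrite cards0.
  pose V := \bigcup_(e in J) e.
  have HV : is_sgraph (V, J).
    rewrite /is_sgraph /=; apply/andP; split.
      have /set0Pn[e eJ] := J_n0; have [e2 _] := edge_spec (subsetP sJ e eJ).
      have /set0Pn[x xe] : e != set0 by rewrite -card_gt0 e2.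
      by apply/set0Pn; exists x; apply/bigcupP; exists e.
    apply/forall_inP => e eJ; have [-> _] := edge_spec (subsetP sJ e eJ).
    exact: bigcup_sup.
  have sHG : subgraph (SGraph HV) G.
    rewrite /subgraph /vertices /edges /= sJ andbT; apply/bigcupsP => e eJ.
    by have [] := edge_spec (subsetP sJ e eJ).
  have -> : \bigcup_(e in J) setX e [set: 'I_k] = setX V [set: 'I_k].
    apply/setP => -[x i]; rewrite in_setX inE andbT.
    apply/bigcupP/bigcupP => -[e eJ].
      by rewrite in_setX => /andP[xe _]; exists e.
    by move=> xe; exists e; rewrite // in_setX xe inE.
  rewrite cardsX cardsT card_ord mulnC.
  apply: leq_trans (ltnW (card_edges_lt sHG)) _; rewrite leq_mul2l.
  apply/orP; right; apply: largest_component_leq => x xV; exists V; split=> //.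
  move=> y z yz; have yV := adj_vertex yz; rewrite adjC in yz.
  by rewrite (adj_vertex yz); rewrite /vertices /= in yV; rewrite yV.
exists (fun x y => adj G x y && ((h [set x; y]).1 == x)); split.
- by move=> x y /andP[].
- move=> x y xy; rewrite [adj G y x]adjC xy /= [[set y; x]]setUC.
  by have := hN _ xy; rewrite inE => /andP[/set2P[]->]; rewrite eqxx ?orbT.
- move=> x y /andP[xy /eqP hx]; rewrite [[set y; x]]setUC hx.
  by rewrite (negPf (adj_neq xy)) andbF.
move=> x; rewrite -[k in _ <= k]card_ord -cardsT.
rewrite -(card_in_imset (f := fun y => (h [set x; y]).2)); first exact: subset_leq_card (subsetT _).
move=> y z; rewrite !inE => /andP[xy /eqP hy] /andP[xz /eqP hz] h2.
have /h_inj : h [set x; y] = h [set x; z].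
  by move: hy hz h2; case: (h _) => ? ?; case: (h _) => ? ? /= -> -> ->.
move=> /(_ xy xz) /set2_eq[[]//|[xz' _]].
by move: (adj_neq xz); rewrite xz' eqxx.
Qed.

(** Otherwise Hall's theorem gives k + 1 disjoint stars with k leaves: k (k+1) edges in components
    of at most k + 1 vertices, against the density bound. *)
Lemma card_high_degree : #|high_degree| <= k.
Proof.
rewrite leqNgt; apply/negP => lt_k.
have [|A [_ sAH cA]] := exists_set_between (m := k.+1) (sub0set high_degree).
  by rewrite cards0.
have /set0Pn[x0 _] := vertices_neq0 G.
pose N (p : T * 'I_k) := neighbours p.1 :\: A.
have [J sJ|h [h_inj hN]] := hall_marriage x0 (N := N)
    (D := setX A [set: 'I_k]).
  have [->|/set0Pn[[a i] aiJ]] := eqVneq J set0; first by rewrite cards0.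
  have aA : a \in A by move/(subsetP sJ): aiJ; rewrite in_setX => /andP[].
  apply: leq_trans (subset_leq_card sJ) _; rewrite cardsX cA cardsT card_ord.
  apply: (@leq_trans #|N (a, i)|); last first.
    by apply: subset_leq_card; apply: (bigcup_sup (a, i)).
  have := subsetP sAH _ aA; rewrite inE /N /= cardsD => leA.
  have := subset_leq_card (subsetIr (neighbours a) A); rewrite cA.
  by move: leA; rewrite expnS expn1; lia.
have hP a i : a \in A -> adj G a (h (a, i)) && (h (a, i) \notin A).
  move=> aA; have := hN (a, i); rewrite in_setX aA !inE => /(_ isT).
  by rewrite andbC.
pose F := [set [set p.1; h p] | p in setX A [set: 'I_k]].
have sF : F \subset edges G.
  apply/subsetP => _ /imsetP[[a i] + ->]; rewrite in_setX => /andP[aA _].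
  by case/andP: (hP a i aA).
have cF : #|F| = k.+1 * k.
  rewrite card_in_imset ?cardsX ?cA ?cardsT ?card_ord //.
  move=> [a i] [b j] aiA bjA /= /set2_eq[[_ hab]|[_ hb]]; first exact: h_inj.
  move: aiA bjA; rewrite !in_setX => /andP[/(hP a i)/andP[_]].
  by rewrite hb => /negPf->.
have := card_edges_lt (spanning_subgraph sF).
rewrite [edges _]/edges /= cF mulnC ltn_pmul2l // ltnNge => /negP[].
apply: largest_component_leq => x _.
(* The hub of the star in which [y] is a leaf, and [y] itself otherwise; its fibres are closed sets
   of at most k + 1 vertices. *)
pose hub y := odflt y [pick a in A | [exists i, h (a, i) == y]].
have hub_leaf a i : a \in A -> hub (h (a, i)) = a.
  move=> aA; rewrite /hub; case: pickP => [b /andP[bA /existsP[j /eqP hb]]|].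
    have := h_inj (b, j) (a, i); rewrite !in_setX aA bA !inE => /(_ isT isT hb).
    by case.
  by move/(_ a); rewrite aA /= => /existsP[]; exists i.
have hub_A a : a \in A -> hub a = a.
  move=> aA; rewrite /hub; case: pickP => // b /andP[bA /existsP[j /eqP hb]].
  by have /andP[_] := hP b j bA; rewrite hb aA.
exists [set y | hub y == hub x]; split; first by rewrite inE.
  move=> y z; rewrite /adj /= /edges /= => /imsetP[[a i]].
  rewrite in_setX => /andP[aA _].
  by case/set2_eq=> [[-> ->]|[-> ->]]; rewrite !inE hub_leaf // (hub_A a).
apply: (@leq_trans #|hub x |: [set h (hub x, i) | i : 'I_k]|).
  apply: subset_leq_card; apply/subsetP => y; rewrite !inE => /eqP <-.
  have [hy|[j hy]] : hub y = y \/ exists j, y = h (hub y, j).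
    rewrite /hub; case: pickP => [b /andP[_ /existsP[j /eqP hb]]|_]; last by left.
    by right; exists j.
  - by rewrite -{1}hy eqxx.
  - by apply/orP; right; apply/imsetP; exists j.
rewrite cardsU1; apply: (@leq_trans (1 + k)) => //; apply: leq_add.
  exact: leq_b1.
by apply: leq_trans (leq_imset_card _ _) _; rewrite card_ord.
Qed.

(** Pairwise disjoint edges form a matching, whose components have at most two vertices. *)
Lemma card_matching (M : {set {set T}}) :
  M \subset edges G -> trivIset M -> #|M| < 2 * k.
Proof.
move=> sM tM; have := card_edges_lt (spanning_subgraph sM).
rewrite [edges _]/edges /= mulnC => /leq_trans; apply.
rewrite leq_mul2r; apply/orP; right; apply: largest_component_leq => x _.
have MP y z e : e \in M -> y \in e -> [set y; z] \in M -> z \in e.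
  move=> eM ye yzM; suff -> : e = [set y; z] by rewrite set22.
  by rewrite -(def_pblock tM eM ye) -(def_pblock tM yzM (set21 _ _)).
have [xM|xM] := boolP (x \in cover M); last first.
  exists [set x]; split; rewrite ?set11 ?cards1 //.
  move=> y z yz; rewrite !inE; apply/eqP/eqP => ?; subst; case/negP: xM.
    by apply/bigcupP; exists [set x; z]; rewrite ?set21.
  by apply/bigcupP; exists [set y; x]; rewrite ?set22.
have eM := pblock_mem xM; exists (pblock M x).
have [e2 _] := edge_spec (subsetP sM _ eM).
split; rewrite ?mem_pblock ?e2 // => y z yz; apply/idP/idP => h.
  exact: MP eM h yz.
by apply: MP eM h _; rewrite setUC.
Qed.

(** The non-isolated vertices of the subgraph induced on low degrees; a vertex outside both this set
    and [high_degree] has only neighbours of high degree. *)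
Definition low_core :=
  [set x | (x \notin high_degree) && [exists y, (y \notin high_degree) && adj G x y]].

(** A maximal matching among low-degree vertices covers at most 4 k of them. By maximality every
    vertex of the core is covered or adjacent to a covered one, and covered vertices have degree
    below (k+1)^2. *)
Lemma card_low_core : #|low_core| <= 4 * k * k.+1 ^ 2.
Proof.
pose P (M : {set {set T}}) :=
  [&& M \subset edges G, trivIset M & [disjoint cover M & high_degree]].
have [|M /maxsetP[/and3P[sM tM dM] maxM]] := @ex_maxset _ P.
  exists set0; rewrite /P sub0set /cover big_set0 -setI_eq0 set0I eqxx andbT /=.
  by apply/trivIsetP => A B; rewrite inE.
have cU : #|cover M| <= 4 * k.
  rewrite -(eqP tM).
  apply: (@leq_trans (\sum_(e in M) 2)); last first.
    by rewrite sum_nat_const; have := card_matching sM tM; lia.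
  by apply: leq_sum => e eM; have [-> _] := edge_spec (subsetP sM _ eM).
have sub : low_core \subset \bigcup_(u in cover M) (u |: neighbours u).
  apply/subsetP => x; rewrite inE => /andP[xA /existsP[y /andP[yA xy]]].
  have [xM|xM] := boolP (x \in cover M).
    by apply/bigcupP; exists x; rewrite ?setU11.
  have [yM|yM] := boolP (y \in cover M).
    by apply/bigcupP; exists y; rewrite // !inE adjC xy orbT.
  have disj2 (B : {set T}) : x \notin B -> y \notin B -> [disjoint [set x; y] & B].
    by move=> xB yB; rewrite disjoint_subset; apply/subsetP => z /set2P[]->.
  have dxy := disj2 _ xM yM.
  have xyM : [set x; y] \in M.
    rewrite -(maxM ([set x; y] |: M)) ?setU11 ?subsetUr //.
    have xyE : [set x; y] \in edges G by [].
    rewrite /P subUset sub1set sM xyE /=; apply/andP; split.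
      have [] // := @trivIsetU1 _ [set x; y] M _ tM.
        by move=> e eM; apply: disjointWr dxy; apply: bigcup_sup.
      by apply/negP => /(subsetP sM)/edge_spec[]; rewrite cards0.
    rewrite /cover bigcup_setU big_set1 -/(cover M).
    rewrite -setI_eq0 setIUl setU_eq0 !setI_eq0 dM andbT.
    exact: disj2.
  by case/negP: xM; apply/bigcupP; exists [set x; y]; rewrite ?set21.
apply: leq_trans (subset_leq_card sub) _.
apply: leq_trans (leq_card_bigcup _ _) _.
apply: leq_trans (_ : #|cover M| * k.+1 ^ 2 <= _); last by rewrite leq_mul2r cU orbT.
rewrite -sum_nat_const; apply: leq_sum => u uM; rewrite cardsU1.
have : u \notin high_degree by rewrite (disjointFr dM uM).
rewrite inE -ltnNge; case: (_ \notin _) => //=; exact: ltnW.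
Qed.
End Density.

(** * Colouring the edges *)

Lemma star_decomposable_log (T : finType) (G : sgraph T) (k : nat) :
    0 < k -> (partition_density G < k%:R)%R ->
  star_decomposable G (k + 10 * trunc_log 2 k + 65).
Proof.
move=> k_gt0 density_lt; set l := trunc_log 2 k; set t := k + _ + _.
have hk : 2 ^ l <= k < 2 ^ l.+1 := trunc_log_bounds (isT : 1 < 2) k_gt0.
have t_gt0 : 0 < t by rewrite /t; lia.
have [d [d_adj adj_d d_asym d_out]] := exists_orientation density_lt k_gt0.
set A := high_degree G k.
have leA : #|A| <= k by apply: card_high_degree.
pose I := ~: (A :|: low_core G k).
have I_adj x y : x \in I -> adj G x y -> y \in A.
  move=> + xy; rewrite in_setC in_setU negb_or => /andP[xA]; apply: contraNT => yA.
  by rewrite inE xA; apply/existsP; exists y; rewrite yA.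
have AI x : x \in A -> x \notin I by move=> xA; rewrite in_setC in_setU xA.
(* Edges at [I] are turned away from [I], the others keep [d]. This is consistent because neighbours
   of [I] lie in [A], hence outside [I]. *)
pose d' : rel T := fun x y =>
  adj G x y && ((x \in I) || ((y \notin I) && d x y)).
have d'_adj x y : d' x y -> adj G x y by case/andP.
have d'_head x y : d' x y -> y \notin I.
  by case/andP=> xy /orP[xI|/andP[]//]; apply: AI (I_adj _ _ xI xy).
have adj_d' x y : adj G x y -> d' x y || d' y x.
  move=> xy; rewrite /d' [adj G y x]adjC xy /=.
  by case: (x \in I); case: (y \in I) => //=; apply: adj_d.
have d'_asym x y : d' x y -> ~~ d' y x.
  move=> dxy; have yI := d'_head _ _ dxy; apply/negP => dyx.
  have xI := d'_head _ _ dyx; move: dxy dyx.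
  rewrite /d' (negPf xI) (negPf yI) /= => /andP[_ dxy] /andP[_].
  by rewrite (negPf (d_asym _ _ dxy)).
(* At most one vertex of I, representing all of them in the union bound. *)
pose Z := [set x | [pick z in I] == Some x].
have cZ : #|Z| <= 1.
  apply/card_le1P => x; rewrite inE => /eqP Zx y.
  by rewrite !inE Zx; apply/eqP/eqP => [[]|->].
have ZI x : x \in Z -> x \in I.
  by rewrite inE; case: pickP => // z zI /eqP[<-].
have exZ x : x \in I -> exists z, z \in Z.
  move=> xI; case E: [pick z in I] => [z|]; first by exists z; rewrite inE E.
  by move: E; case: pickP => // /(_ x); rewrite xI.
pose W x := if x \in I then A else [set y | d' x y].
have cK : #|A :|: low_core G k :|: Z| <= 4 * k.+1 ^ 3.
  apply: leq_trans (leq_card_setU _ _) _.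
  apply: leq_trans (leq_add (leq_card_setU _ _) cZ) _.
  have := card_low_core density_lt k_gt0; rewrite !expnS expn0; nia.
have [||f goodf] := @exists_good_draw T t (6 * l + 14) k l _ W hk erefl erefl cK.
- move=> u _; rewrite /W; case: ifP => [uI|_]; first by apply: contraL uI => /AI.
  by rewrite inE; apply/negP => /d'_adj/adj_neq; rewrite eqxx.
- move=> u _; rewrite /W; case: ifP => // uI.
  apply: leq_trans (d_out u); apply: subset_leq_card; apply/subsetP => y.
  by rewrite !inE /d' uI => /and3P[].
pose S x := if x \in I then set0 else colors_at f x.
have exmu u : exists mu : T -> 'I_t,
    {in [set y | d' u y] &, injective mu} /\
    (forall v, v \in [set y | d' u y] -> mu v \in colors_at f v :\: S u).
  (* Here [z] is [u] itself, or the representative when [u] is in [I]. A choice made at [z] suits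
     [u], since it serves all heads of edges leaving [u] and avoids at least the colours of
     [S u]. *)
  have [z [zK sW sS]] : exists z, [/\ z \in A :|: low_core G k :|: Z,
      [set y | d' u y] \subset W z & S u \subset colors_at f z].
    have [uI|uI] := boolP (u \in I).
      have [z zZ] := exZ u uI; exists z; split; first by rewrite inE zZ orbT.
        rewrite /W (ZI z zZ); apply/subsetP => y; rewrite inE => /d'_adj.
        exact: I_adj.
      by rewrite /S uI sub0set.
    exists u; rewrite /W /S (negPf uI); split=> //.
    by move: uI; rewrite inE negbK => uI; rewrite inE uI.
  have [mu [mu_inj muN]] :=
    hall_marriage (Ordinal t_gt0) (N := fun v => colors_at f v :\: colors_at f z)
      (goodf z zK).
  exists mu; split=> [v w vW wW|v vW].
    by apply: mu_inj; apply: (subsetP sW).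
  by apply: (subsetP (setDS _ sS)); apply: muN; apply: (subsetP sW).
have [mu mu_ok] := fin_all_exists exmu.
apply: (star_decomposable_of_orientation (d := d') (col := mu)) => //.
  (* The head [y] lies outside [I], so the colour of xy belongs to [S y], which the colour of yz
     avoids. *)
  move=> x y z dxy dyz; apply/eqP => eq_mu.
  have [_ /(_ y)] := mu_ok x; have [_ /(_ z)] := mu_ok y.
  rewrite !inE dxy dyz -eq_mu /S (negPf (d'_head _ _ dxy)).
  by move=> /(_ isT)/andP[/negPf->] _ /(_ isT); rewrite andbF.
move=> x y z dxy dxz; have [inj_mu _] := mu_ok x.
by apply: inj_mu; rewrite inE.
Qed.

(** * From binary to natural logarithms *)

Local Open Scope ring_scope.

(** Exactly what turns 10 binary logarithms into 15 natural ones. From exp(-1/15) >= 14/15 one gets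
    exp(2/3) <= (15/14)^10 <= 2. *)
Lemma ln2_ge (R : realType) : 2 / 3 <= ln (2 : R).
Proof.
rewrite -[leLHS]expRK ler_ln ?posrE ?expR_gt0 //.
have -> : 2 / 3 = 10%:R * (1 / 15) :> R by lra.
rewrite expRM_natl.
have e1 : expR (1 / 15) <= 15 / 14 :> R.
  have := expR_ge1Dx (- (1 / 15) : R); have := expRxMexpNx_1 (1 / 15 : R).
  by have := expR_gt0 (1 / 15 : R); nra.
apply: le_trans (lerXn2r _ _ _ e1) _; rewrite ?nnegrE ?expR_ge0 //; lra.
Qed.

Lemma trunc_log2_ln (R : realType) (k : nat) : (0 < k)%N ->
  10 * (trunc_log 2 k)%:R <= 15 * ln (k%:R : R).
Proof.
move=> k_gt0; have /andP[lek _] := trunc_log_bounds (isT : (1 < 2)%N) k_gt0.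
have : (trunc_log 2 k)%:R * ln (2 : R) <= ln (k%:R : R).
  rewrite mulr_natl -lnXn // ler_ln ?posrE ?exprn_gt0 ?ltr0n //.
  by rewrite -natrX ler_nat.
have := ln2_ge R; have := ler0n R (trunc_log 2 k); nra.
Qed.

Theorem theorem1p4 (R : realType) (T : finType) (G : sgraph T) (k : nat)
    (hk : (1 <= k)%N) (hG : partition_density G < k%:R) :
  (star_arboricity G)%:R <= k%:R + 15%:R * ln (k%:R : R) + 65%:R :> R.
Proof.
apply: (@le_trans _ _ (k + 10 * trunc_log 2 k + 65)%N%:R).
  rewrite ler_nat /star_arboricity; case: ex_minnP => m _; apply.
  exact: star_decomposable_log.
by rewrite 2!natrD lerD2r lerD2l natrM; apply: trunc_log2_ln.
Qed.
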